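(* Let $H$ be a Hopf algebra over a field $\Bbbk$, let $A$ be an associative (not necessarily unital) $\Bbbk$-algebra and let $\cdot:H\otimes A\to A$ be a symmetrical partial action. Let $\varphi:A\to\operatorname{Hom}_\Bbbk(H,A)$ be given by $\varphi(a)(h)=h\cdot a$ and let $B=H\triangleright\varphi(A)\subseteq\operatorname{Hom}_\Bbbk(H,A)$. Then the pair $(B,\varphi)$ is a minimal globalization for $\cdot$.
   Context: $\Delta(h)=\sum h_{(1)}\otimes h_{(2)}$. A partial action of $H$ on an associative algebra $A$ is a linear map $\cdot:H\otimes A\to A$ with, for all $a,b\in A$, $h,k\in H$: $1_H\cdot a=a$ and $h\cdot(a(k\cdot b))=\sum(h_{(1)}\cdot a)(h_{(2)}k\cdot b)$. It is symmetrical if also $h\cdot((k\cdot b)a)=\sum(h_{(1)}k\cdot b)(h_{(2)}\cdot a)$. A (possibly nonunital) $H$-module algebra is an algebra $B$ that is a left $H$-module via $\triangleright$ with $h\triangleright(bc)=\sum(h_{(1)}\triangleright b)(h_{(2)}\triangleright c)$. A globalization for a symmetrical partial action $\cdot$ on $A$ is a pair $(B,\theta)$ such that: (1) $B$ is a (possibly nonunital) $H$-module algebra with action $\triangleright$; (2) $\theta:A\to B$ is an injective algebra morphism; (3) $\theta((h\cdot a)b)=(h\triangleright\theta(a))\theta(b)$ and $\theta(b(h\cdot a))=\theta(b)(h\triangleright\theta(a))$ for all $a,b\in A$, $h\in H$; (4) $B=H\triangleright\theta(A)$ (the linear span of all $h\triangleright\theta(a)$); (5) $h\bullet\theta(a)=\theta(h\cdot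 a)$ defines a partial action of $H$ on $\theta(A)$. The globalization is minimal if, for all finite families $h_i\in H$, $a_i\in A$, the condition $\sum_i kh_i\cdot a_i=0$ for all $k\in H$ implies $\sum_i h_i\triangleright\theta(a_i)=0$. $\operatorname{Hom}_\Bbbk(H,A)$ is an algebra under convolution, $(fg)(h)=\sum f(h_{(1)})g(h_{(2)})$, and an $H$-module algebra via $(k\triangleright f)(h)=f(hk)$; $H\triangleright\varphi(A)$ is the linear span of all $h\triangleright\varphi(a)$. *)

(* Defs.v *)
From HB Require Import structures.
From mathcomp Require Import all_boot all_order all_algebra generic_quotient.
From mathcomp Require Import boolp.

Set Implicit Arguments.
Unset Strict Implicit.
Unset Printing Implicit Defensive.

Import GRing.Theory.
Local Open Scope ring_scope.
Local Open Scope quotient_scope.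

Declare Scope hopf_scope.
Delimit Scope hopf_scope with H.
Local Open Scope hopf_scope.

Reserved Notation "u '⊗' v" (at level 39, left associativity).
Reserved Notation "a '⋆' b" (at level 40, left associativity).

(** The list [:: (u1, v1); ...; (un, vn)] stands for the formal sum
    u1 ⊗ v1 + ... + un ⊗ vn; [tensor_eq] is the congruence on formal sums
    generated by commutativity and bilinearity. *)
Inductive tensor_eq (k : fieldType) (U V : lmodType k) :
    seq (U * V) -> seq (U * V) -> Prop :=
| teq_refl s : tensor_eq s s
| teq_sym s t : tensor_eq s t -> tensor_eq t s
| teq_trans s t r : tensor_eq s t -> tensor_eq t r -> tensor_eq s r
| teq_cat s s' t t' :
    tensor_eq s s' -> tensor_eq t t' -> tensor_eq (s ++ t) (s' ++ t')
| teq_comm s t : tensor_eq (s ++ t) (t ++ s)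
| teq_addl u u' v : tensor_eq [:: (u + u', v)] [:: (u, v); (u', v)]
| teq_addr u v v' : tensor_eq [:: (u, v + v')] [:: (u, v); (u, v')]
| teq_scale (a : k) u v : tensor_eq [:: (a *: u, v)] [:: (u, a *: v)]
| teq_zero v : tensor_eq [:: (0, v)] [::].

Section Tensor.
Context (k : fieldType) (U V : lmodType k).
Implicit Types (s t r : seq (U * V)) (u : U) (v : V) (a b : k).

Definition tensor_eqb s t : bool := `[< tensor_eq s t >].

Lemma tensor_eqb_refl : reflexive tensor_eqb.
Proof. by move=> s; apply/asboolP; exact: teq_refl. Qed.

Lemma tensor_eqb_sym : symmetric tensor_eqb.
Proof. by move=> s t; apply/asboolP/asboolP; exact: teq_sym. Qed.

Lemma tensor_eqb_trans : transitive tensor_eqb.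
Proof. by move=> t s r /asboolP st /asboolP tr; apply/asboolP/(teq_trans st). Qed.

Canonical tensor_equiv :=
  EquivRel tensor_eqb tensor_eqb_refl tensor_eqb_sym tensor_eqb_trans.

Definition tensor := {eq_quot tensor_equiv}.
HB.instance Definition _ := Choice.on tensor.

Definition tens_of s : tensor := \pi_tensor s.
Definition tens_repr (x : tensor) : seq (U * V) := repr x.

Lemma tens_reprK x : tens_of (tens_repr x) = x.
Proof. exact: reprK. Qed.

Lemma tens_ofP s t : tens_of s = tens_of t <-> tensor_eq s t.
Proof.
split; first by move/eqP; rewrite eqmodE => /asboolP.
by move=> st; apply/eqP; rewrite eqmodE; apply/asboolP.
Qed.

Lemma tens_repr_eq s : tensor_eq (tens_repr (tens_of s)) s.
Proof. by apply/tens_ofP; exact: tens_reprK. Qed.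

Definition tens_scale_seq a s : seq (U * V) := [seq (a *: p.1, p.2) | p <- s].

Lemma tens_scale_seq_eq a s t :
  tensor_eq s t -> tensor_eq (tens_scale_seq a s) (tens_scale_seq a t).
Proof.
elim=> {s t} [s|s t _|s t r _ st _ tr|s s' t t' _ ss' _ tt'|s t|u u' v|u v v'
             |b u v|v].
- exact: teq_refl.
- exact: teq_sym.
- exact: teq_trans st tr.
- by rewrite /tens_scale_seq !map_cat; exact: teq_cat.
- by rewrite /tens_scale_seq !map_cat; exact: teq_comm.
- by rewrite /tens_scale_seq /= scalerDr; exact: teq_addl.
- exact: teq_addr.
- rewrite /tens_scale_seq /= scalerA mulrC -scalerA; exact: teq_scale.
- rewrite /tens_scale_seq /= scaler0; exact: teq_zero.
Qed.

Definition tens_add (x y : tensor) : tensor :=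
  tens_of (tens_repr x ++ tens_repr y).
Definition tens_scale a (x : tensor) : tensor :=
  tens_of (tens_scale_seq a (tens_repr x)).
Definition tens_zero : tensor := tens_of [::].
Definition tens_opp (x : tensor) : tensor := tens_scale (- 1) x.

Lemma tens_addE s t : tens_add (tens_of s) (tens_of t) = tens_of (s ++ t).
Proof. by apply/tens_ofP/teq_cat; exact: tens_repr_eq. Qed.

Lemma tens_scaleE a s : tens_scale a (tens_of s) = tens_of (tens_scale_seq a s).
Proof. by apply/tens_ofP/tens_scale_seq_eq; exact: tens_repr_eq. Qed.

Lemma tens_addA : associative tens_add.
Proof.
move=> x y z; rewrite -(tens_reprK x) -(tens_reprK y) -(tens_reprK z).
by rewrite !tens_addE catA.
Qed.

Lemma tens_addC : commutative tens_add.
Proof.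
move=> x y; rewrite -(tens_reprK x) -(tens_reprK y) !tens_addE.
by apply/tens_ofP; exact: teq_comm.
Qed.

Lemma tens_add0 : left_id tens_zero tens_add.
Proof. by move=> x; rewrite -(tens_reprK x) tens_addE. Qed.

Lemma tens_scaleDl_seq a b s :
  tens_of (tens_scale_seq (a + b) s) =
  tens_of (tens_scale_seq a s ++ tens_scale_seq b s).
Proof.
elim: s => [|[u v] s IH] //=.
rewrite -cat1s -tens_addE IH -tens_addE.
have -> : tens_of [:: ((a + b) *: u, v)] =
          tens_add (tens_of [:: (a *: u, v)]) (tens_of [:: (b *: u, v)]).
  by rewrite tens_addE scalerDl; apply/tens_ofP; exact: teq_addl.
rewrite -!tens_addA (tens_addC (tens_of [:: (b *: u, v)])) -!tens_addA.
rewrite (tens_addC (tens_of (tens_scale_seq b s))) !tens_addE /=.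
by rewrite -cat_cons.
Qed.

Lemma tens_scale0_seq s : tens_of (tens_scale_seq 0 s) = tens_zero.
Proof.
elim: s => [|[u v] s IH] //=.
rewrite -cat1s -tens_addE IH scale0r.
have -> : tens_of [:: (0, v)] = tens_zero by apply/tens_ofP; exact: teq_zero.
exact: tens_add0.
Qed.

Lemma tens_scale1 : left_id 1 tens_scale.
Proof.
move=> x; rewrite -(tens_reprK x) tens_scaleE; congr tens_of.
by rewrite /tens_scale_seq -[RHS]map_id; apply: eq_map => -[u v] /=; rewrite scale1r.
Qed.

Lemma tens_addN : left_inverse tens_zero tens_opp tens_add.
Proof.
move=> x; rewrite -[X in tens_add _ X]tens_scale1 -(tens_reprK x) /tens_opp.
by rewrite !tens_scaleE tens_addE -tens_scaleDl_seq addNr tens_scale0_seq.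
Qed.

HB.instance Definition _ :=
  GRing.isZmodule.Build tensor tens_addA tens_addC tens_add0 tens_addN.

Lemma tens_scaleA a b x : tens_scale a (tens_scale b x) = tens_scale (a * b) x.
Proof.
rewrite -(tens_reprK x) !tens_scaleE; congr tens_of.
by rewrite /tens_scale_seq -map_comp; apply: eq_map => -[u v] /=; rewrite scalerA.
Qed.

Lemma tens_scaleDr : right_distributive tens_scale +%R.
Proof.
move=> a x y; change (tens_scale a (tens_add x y) =
  tens_add (tens_scale a x) (tens_scale a y)).
rewrite -(tens_reprK x) -(tens_reprK y) !(tens_addE, tens_scaleE).
by rewrite /tens_scale_seq map_cat.
Qed.

Lemma tens_scaleDl x : {morph tens_scale^~ x : a b / a + b}.
Proof.
move=> a b; change (tens_scale (a + b) x =
  tens_add (tens_scale a x) (tens_scale b x)).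
by rewrite -(tens_reprK x) !tens_scaleE tens_addE tens_scaleDl_seq.
Qed.

HB.instance Definition _ := GRing.Zmodule_isLmodule.Build k tensor
  tens_scaleA tens_scale1 tens_scaleDr tens_scaleDl.

Definition tens u v : tensor := tens_of [:: (u, v)].

Lemma tens_of_cat s t : tens_of (s ++ t) = tens_of s + tens_of t.
Proof. by rewrite -tens_addE. Qed.

Lemma tens_of_nil : tens_of [::] = 0.
Proof. by []. Qed.

Lemma tens_ofE s : tens_of s = \sum_(p <- s) tens p.1 p.2.
Proof.
elim: s => [|[u v] s IH]; first by rewrite big_nil.
by rewrite big_cons -IH -tens_of_cat.
Qed.

Lemma tens_bilinear : bilinear_for
  (GRing.Scale.Law.clone _ _ *:%R _) (GRing.Scale.Law.clone _ _ *:%R _) tens.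
Proof.
have tDl u u' v : tens (u + u') v = tens u v + tens u' v.
  by rewrite -tens_of_cat; apply/tens_ofP; exact: teq_addl.
have tDr u v v' : tens u (v + v') = tens u v + tens u v'.
  by rewrite -tens_of_cat; apply/tens_ofP; exact: teq_addr.
have tZl a u v : tens (a *: u) v = a *: tens u v.
  by rewrite -[RHS]/(tens_scale a (tens_of _)) tens_scaleE.
have tZr a u v : tens u (a *: v) = a *: tens u v.
  by rewrite -tZl; apply/tens_ofP/teq_sym; exact: teq_scale.
by split=> [v|u] a x y /=; rewrite ?tDl ?tZl ?tDr ?tZr.
Qed.

HB.instance Definition _ :=
  bilinear_isBilinear.Build k U V tensor _ _ tens tens_bilinear.

End Tensor.

Notation "u ⊗ v" := (tens u v) : hopf_scope.

(** [sweedler f t] is the sum of the f u_i v_i for t = u_1 ⊗ v_1 + ... +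
    u_n ⊗ v_n.  The sum is taken over a chosen representative of t; by
    [sweedlerE] it does not depend on that choice when f is bilinear, which is
    the only case in which it is used below. *)
Definition sweedler (k : fieldType) (U V : lmodType k) (W : nmodType)
    (f : U -> V -> W) (t : tensor U V) : W :=
  \sum_(p <- tens_repr t) f p.1 p.2.

Lemma linear_sweedler (k : fieldType) (U V : lmodType k) (W W' : lmodType k)
    (g : W -> W') (f : U -> V -> W) (t : tensor U V) :
  linear g -> g (sweedler f t) = sweedler (fun x y => g (f x y)) t.
Proof.
move=> gL; rewrite /sweedler; elim: (tens_repr t) => [|p s IH].
  by rewrite !big_nil -[X in g X](addNr 0) -scaleN1r gL scaleN1r addNr.
by rewrite !big_cons -IH -[f _ _ in LHS]scale1r gL scale1r.
Qed.

Section Sweedler.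
Context (k : fieldType) (U V W : lmodType k) (f : U -> V -> W).
Context (fl : forall v, linear (f^~ v)) (fr : forall u, linear (f u)).

Lemma tensor_eq_sum (s t : seq (U * V)) :
  tensor_eq s t -> \sum_(p <- s) f p.1 p.2 = \sum_(p <- t) f p.1 p.2.
Proof.
have f0 v : f 0 v = 0.
  by rewrite -[X in f X](addNr 0) -scaleN1r fl scaleN1r addNr.
have fr0 u : f u 0 = 0.
  by rewrite -[X in f _ X](addNr 0) -scaleN1r fr scaleN1r addNr.
elim=> {s t} [s|s t _|s t r _ -> _ ->|s s' t t' _ e _ e'|s t|u u' v|u v v'
             |a u v|v] //.
- by rewrite !big_cat /= e e'.
- by rewrite !big_cat /= addrC.
- by rewrite !big_cons !big_nil /= !addr0 -[u in LHS]scale1r fl scale1r.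
- by rewrite !big_cons !big_nil /= !addr0 -[v in LHS]scale1r fr scale1r.
- rewrite !big_cons !big_nil /= !addr0 -[a *: u]addr0 fl f0 addr0.
  by rewrite -[a *: v]addr0 fr fr0 addr0.
- by rewrite big_cons !big_nil /= f0 addr0.
Qed.

Lemma sweedlerE (s : seq (U * V)) :
  sweedler f (tens_of s) = \sum_(p <- s) f p.1 p.2.
Proof. by apply: tensor_eq_sum; exact: tens_repr_eq. Qed.

Lemma sweedler_tens (u : U) (v : V) : sweedler f (u ⊗ v) = f u v.
Proof. by rewrite sweedlerE big_seq1. Qed.

Lemma sweedler_linear : linear (sweedler f).
Proof.
move=> a x y; rewrite -(tens_reprK x) -(tens_reprK y).
have -> : a *: tens_of (tens_repr x) = tens_of (tens_scale_seq a (tens_repr x)).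
  exact: tens_scaleE.
rewrite -tens_of_cat !sweedlerE big_cat big_map scaler_sumr; congr (_ + _).
apply: eq_bigr => p _ /=.
rewrite -[a *: p.1]addr0 fl -[X in _ + f X _](addNr 0) -scaleN1r fl.
by rewrite scaleN1r addNr addr0.
Qed.

End Sweedler.

Definition tens_mul (k : fieldType) (H : algType k) (s t : tensor H H) :
    tensor H H :=
  sweedler (fun x y => sweedler (fun x' y' => (x * x') ⊗ (y * y')) t) s.

HB.mixin Record Algebra_isHopf (k : fieldType) H of GRing.Algebra k H := {
  comul : {linear H -> tensor H H};
  counit : {scalar H};
  antipode : {linear H -> H};
  comulA : forall h,
    sweedler (fun x y => sweedler (fun x1 x2 => x1 ⊗ (x2 ⊗ y)) (comul x))
      (comul h) =
    sweedler (fun x y => sweedler (fun y1 y2 => x ⊗ (y1 ⊗ y2)) (comul y))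
      (comul h);
  comul_counitl : forall h, sweedler (fun x y => counit x *: y) (comul h) = h;
  comul_counitr : forall h, sweedler (fun x y => counit y *: x) (comul h) = h;
  comul1 : comul 1 = 1 ⊗ 1;
  comulM : forall g h, comul (g * h) = tens_mul (comul g) (comul h);
  counit1 : counit 1 = 1;
  counitM : forall g h, counit (g * h) = counit g * counit h;
  antipodel : forall h,
    sweedler (fun x y => antipode x * y) (comul h) = counit h *: 1;
  antipoder : forall h,
    sweedler (fun x y => x * antipode y) (comul h) = counit h *: 1
}.

#[short(type="hopfAlgType")]
HB.structure Definition HopfAlgebra (k : fieldType) :=
  {H of GRing.Algebra k H & Algebra_isHopf k H}.

HB.mixin Record Lmodule_isNuAlgebra (k : fieldType) A of GRing.Lmodule k A := {
  numul : A -> A -> A;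
  numulA : associative numul;
  numul_linearl : forall b, linear (numul^~ b);
  numul_linearr : forall a, linear (numul a)
}.

#[short(type="nuAlgType")]
HB.structure Definition NuAlgebra (k : fieldType) :=
  {A of GRing.Lmodule k A & Lmodule_isNuAlgebra k A}.

Notation "a ⋆ b" := (numul a b) : hopf_scope.

Lemma numul_bilinear (k : fieldType) (A : nuAlgType k) : bilinear_for
  (GRing.Scale.Law.clone k A *:%R _) (GRing.Scale.Law.clone k A *:%R _)
  (@numul k A).
Proof. by split; [exact: numul_linearl | exact: numul_linearr]. Qed.

HB.instance Definition _ (k : fieldType) (A : nuAlgType k) :=
  bilinear_isBilinear.Build k A A A _ _ (@numul k A) (@numul_bilinear k A).

Record nualg_morphism (k : fieldType) (A B : nuAlgType k) (f : A -> B) :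
    Prop := NualgMorphism {
  nualg_morphism_linear : linear f;
  nualg_morphismM : forall a b, f (a ⋆ b) = f a ⋆ f b
}.

Definition in_span (k : fieldType) (V : lmodType k) (X : V -> Prop) (v : V) :
    Prop :=
  exists2 s : seq (k * V), forall p, p \in s -> X p.2 &
    v = \sum_(p <- s) p.1 *: p.2.

Record nusubalg_closed (k : fieldType) (B : nuAlgType k) (S : B -> Prop) :
    Prop := NusubalgClosed {
  nusubalg_closed0 : S 0;
  nusubalg_closedP : forall (c : k) a b, S a -> S b -> S (c *: a + b);
  nusubalg_closedM : forall a b, S a -> S b -> S (a ⋆ b)
}.

(** [hS] is a phantom argument: the algebra structure of [nusubalg hS] is
    found by unification from it. *)
Definition nusubalg_pred (k : fieldType) (B : nuAlgType k) (S : B -> Prop)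
  (hS : nusubalg_closed S) : pred B := fun b => `[< S b >].

Definition nusubalg (k : fieldType) (B : nuAlgType k) (S : B -> Prop)
  (hS : nusubalg_closed S) := {b : B | nusubalg_pred hS b}.

Section SubAlgebra.
Context (k : fieldType) (B : nuAlgType k) (S : B -> Prop).
Context (hS : nusubalg_closed S).

Lemma nusubalg_submod_closed : subsemimod_closed (nusubalg_pred hS).
Proof.
have S0 := nusubalg_closed0 hS; have SP := nusubalg_closedP hS.
split; first split.
- exact/asboolP.
- move=> a b /asboolP Sa /asboolP Sb; apply/asboolP.
  by rewrite -[a]scale1r; exact: SP.
- move=> c a /asboolP Sa; apply/asboolP.
  by rewrite -[_ *: _]addr0; exact: SP.
Qed.

HB.instance Definition _ := [isSub of nusubalg hS for @sval _ _].
HB.instance Definition _ := [Choice of nusubalg hS by <:].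
HB.instance Definition _ := GRing.SubChoice_isSubLmodule.Build k B
  (nusubalg_pred hS) (nusubalg hS) nusubalg_submod_closed.

Definition to_nusubalg (b : B) (Sb : S b) : nusubalg hS := exist _ b (asboolT Sb).

Lemma nusubalgP (b : nusubalg hS) : S (val b).
Proof. by apply/asboolP; exact: (valP b). Qed.

Definition nusubalg_mul (a b : nusubalg hS) : nusubalg hS :=
  to_nusubalg (nusubalg_closedM hS (nusubalgP a) (nusubalgP b)).

Lemma nusubalg_mulA : associative nusubalg_mul.
Proof. by move=> a b c; apply: val_inj; exact: numulA. Qed.

Lemma nusubalg_mul_linearl b : linear (nusubalg_mul^~ b).
Proof.
move=> c x y; apply: val_inj; rewrite [RHS]linearP.
rewrite -[LHS]/(val (c *: x + y) ⋆ val b) linearP.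
exact: numul_linearl.
Qed.

Lemma nusubalg_mul_linearr a : linear (nusubalg_mul a).
Proof.
move=> c x y; apply: val_inj; rewrite [RHS]linearP.
rewrite -[LHS]/(val a ⋆ val (c *: x + y)) linearP.
exact: numul_linearr.
Qed.

HB.instance Definition _ := Lmodule_isNuAlgebra.Build k (nusubalg hS)
  nusubalg_mulA nusubalg_mul_linearl nusubalg_mul_linearr.

End SubAlgebra.

Definition image_of (A B : Type) (f : A -> B) (b : B) : Prop := exists a, b = f a.

Lemma image_nusubalg_closed (k : fieldType) (A B : nuAlgType k) (f : A -> B) :
  nualg_morphism f -> nusubalg_closed (image_of f).
Proof.
move=> [fL fM]; split.
- by exists (-1 *: 0 + 0); rewrite fL scaleN1r addNr.
- by move=> c _ _ [a ->] [b ->]; exists (c *: a + b); rewrite fL.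
- by move=> _ _ [a ->] [b ->]; exists (a ⋆ b); rewrite fM.
Qed.

(** A linear map H ⊗ A -> A is given as a bilinear map H -> A -> A. *)
Record partial_action (k : fieldType) (H : hopfAlgType k) (A : nuAlgType k)
    (act : {bilinear H -> A -> A}) : Prop := PartialAction {
  partial_action1 : forall a, act 1 a = a;
  partial_actionM : forall (h g : H) (a b : A),
    act h (a ⋆ act g b) =
    sweedler (fun h1 h2 => act h1 a ⋆ act (h2 * g) b) (comul h)
}.

Record symmetrical_partial_action (k : fieldType) (H : hopfAlgType k)
    (A : nuAlgType k) (act : {bilinear H -> A -> A}) : Prop :=
    SymmetricalPartialAction {
  symmetrical_partial : partial_action act;
  symmetrical_actionM : forall (h g : H) (a b : A),
    act h (act g b ⋆ a) =
    sweedler (fun h1 h2 => act (h1 * g) b ⋆ act h2 a) (comul h)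
}.

Record module_algebra (k : fieldType) (H : hopfAlgType k) (B : nuAlgType k)
    (act : {bilinear H -> B -> B}) : Prop := ModuleAlgebra {
  module_algebra1 : forall b, act 1 b = b;
  module_algebraA : forall (h g : H) (b : B), act (h * g) b = act h (act g b);
  module_algebraM : forall (h : H) (b c : B),
    act h (b ⋆ c) = sweedler (fun h1 h2 => act h1 b ⋆ act h2 c) (comul h)
}.

(** The linear span H ▷ f(A). *)
Definition act_span (k : fieldType) (H : hopfAlgType k) (A : Type)
    (B : lmodType k) (act : H -> B -> B) (f : A -> B) : B -> Prop :=
  in_span (fun b => exists (h : H) (a : A), b = act h (f a)).

Record globalization (k : fieldType) (H : hopfAlgType k) (A : nuAlgType k)
    (pact : {bilinear H -> A -> A}) (B : nuAlgType k)
    (act : {bilinear H -> B -> B}) (theta : A -> B) : Prop := Globalization {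
  glob_module_algebra : module_algebra act;
  glob_morphism : nualg_morphism theta;
  glob_injective : injective theta;
  glob_mull : forall (h : H) (a b : A),
    theta (pact h a ⋆ b) = act h (theta a) ⋆ theta b;
  glob_mulr : forall (h : H) (a b : A),
    theta (b ⋆ pact h a) = theta b ⋆ act h (theta a);
  glob_span : forall b : B, act_span act theta b;
  glob_partial :
    let thetaA := nusubalg (image_nusubalg_closed glob_morphism) in
    exists2 bullet : {bilinear H -> thetaA -> thetaA},
      forall (h : H) (a : A) (x : thetaA),
        val x = theta a -> val (bullet h x) = theta (pact h a) &
      partial_action bullet
}.

Record minimal_globalization (k : fieldType) (H : hopfAlgType k)
    (A : nuAlgType k) (pact : {bilinear H -> A -> A}) (B : nuAlgType k)
    (act : {bilinear H -> B -> B}) (theta : A -> B) : Prop :=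
    MinimalGlobalization {
  minimal_globalizationW : globalization pact act theta;
  minimal_globalizationP : forall (n : nat) (h : 'I_n -> H) (a : 'I_n -> A),
    (forall g : H, \sum_(i < n) pact (g * h i) (a i) = 0) ->
    \sum_(i < n) act (h i) (theta (a i)) = 0
}.

Section SubAction.
Context (k : fieldType) (H : hopfAlgType k) (B : nuAlgType k) (S : B -> Prop).
Context (act : {bilinear H -> B -> B}) (hS : nusubalg_closed S).
Context (hact : forall (h : H) (b : B), S b -> S (act h b)).

Definition sub_action (h : H) (b : nusubalg hS) : nusubalg hS :=
  to_nusubalg hS (hact h (nusubalgP b)).

Lemma sub_action_bilinear : bilinear_for
  (GRing.Scale.Law.clone k (nusubalg hS) *:%R _)
  (GRing.Scale.Law.clone k (nusubalg hS) *:%R _) sub_action.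
Proof.
split=> [b|h] c x y; apply: val_inj; rewrite [RHS]linearP /=.
  exact: linearPl.
rewrite -[LHS]/(act h (val (c *: x + y))) [val (_ + _)]linearP.
exact: linearPr.
Qed.

HB.instance Definition _ := bilinear_isBilinear.Build k H (nusubalg hS)
  (nusubalg hS) _ _ sub_action sub_action_bilinear.

End SubAction.
Arguments sub_action {k H B S} act hS hact h b.

(** An alias of the type of linear maps, which carries the vector space
    structure and, for a Hopf algebra U and an algebra V, the convolution. *)
Definition linhom (k : fieldType) (U V : lmodType k) := {linear U -> V}.

Section Hom.
Context (k : fieldType) (U V : lmodType k).

Definition linhom_linear (f : linhom U V) : {linear U -> V} := f.
Coercion linhom_linear : linhom >-> GRing.Linear.type.

Lemma linhomP (f g : linhom U V) : f =1 g -> f = g.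
Proof.
case: f g => f fc [g gc] /funext /= fg.
case: _ / fg gc => gc; congr GRing.Linear.Pack.
case: fc gc => [[a] [b]] [[c] [d]].
by rewrite (Prop_irrelevance a c) (Prop_irrelevance b d).
Qed.

HB.instance Definition _ := gen_eqMixin (linhom U V).
HB.instance Definition _ := gen_choiceMixin (linhom U V).

Definition mk_linhom (f : U -> V) (fL : linear f) : linhom U V :=
  HB.pack_for {linear U -> V} f (GRing.isLinear.Build k U V *:%R f fL).

Fact linhom0_linear : linear (fun _ : U => 0 : V).
Proof. by move=> a x y; rewrite scaler0 addr0. Qed.

Fact linhom_add_linear (f g : linhom U V) : linear (fun x => f x + g x).
Proof. by move=> a x y; rewrite !linearP scalerDr addrACA. Qed.

Fact linhom_scale_linear (c : k) (f : linhom U V) : linear (fun x => c *: f x).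
Proof. by move=> a x y; rewrite linearP scalerDr !scalerA mulrC. Qed.

Definition linhom0 := mk_linhom linhom0_linear.
Definition linhom_add f g := mk_linhom (linhom_add_linear f g).
Definition linhom_scale c f := mk_linhom (linhom_scale_linear c f).
Definition linhom_opp f := linhom_scale (- 1) f.

Fact linhom_addA : associative linhom_add.
Proof. by move=> f g h; apply: linhomP => x /=; rewrite addrA. Qed.
Fact linhom_addC : commutative linhom_add.
Proof. by move=> f g; apply: linhomP => x /=; rewrite addrC. Qed.
Fact linhom_add0 : left_id linhom0 linhom_add.
Proof. by move=> f; apply: linhomP => x /=; rewrite add0r. Qed.
Fact linhom_addN : left_inverse linhom0 linhom_opp linhom_add.
Proof. by move=> f; apply: linhomP => x /=; rewrite scaleN1r addNr. Qed.

HB.instance Definition _ := GRing.isZmodule.Build (linhom U V)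
  linhom_addA linhom_addC linhom_add0 linhom_addN.

Fact linhom_scaleA a b f :
  linhom_scale a (linhom_scale b f) = linhom_scale (a * b) f.
Proof. by apply: linhomP => x /=; rewrite scalerA. Qed.
Fact linhom_scale1 : left_id 1 linhom_scale.
Proof. by move=> f; apply: linhomP => x /=; rewrite scale1r. Qed.
Fact linhom_scaleDr : right_distributive linhom_scale +%R.
Proof. by move=> a f g; apply: linhomP => x /=; rewrite scalerDr. Qed.
Fact linhom_scaleDl f : {morph linhom_scale^~ f : a b / a + b}.
Proof. by move=> a b; apply: linhomP => x /=; rewrite scalerDl. Qed.

HB.instance Definition _ := GRing.Zmodule_isLmodule.Build k (linhom U V)
  linhom_scaleA linhom_scale1 linhom_scaleDr linhom_scaleDl.

Lemma linhom_addE (f g : linhom U V) x : (f + g) x = f x + g x.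
Proof. by []. Qed.

Lemma linhom_scalE c (f : linhom U V) x : (c *: f) x = c *: f x.
Proof. by []. Qed.

End Hom.

Section Convolution.
Context (k : fieldType) (H : hopfAlgType k) (A : nuAlgType k).
Implicit Types f g l : linhom H A.

Fact conv_bilinl f g y : linear (fun x => f x ⋆ g y).
Proof. by move=> a x x'; rewrite linearP; exact: numul_linearl. Qed.

Fact conv_bilinr f g x : linear (fun y => f x ⋆ g y).
Proof. by move=> a y y'; rewrite linearP; exact: numul_linearr. Qed.

Fact conv_linear f g :
  linear (fun h : H => sweedler (fun x y => f x ⋆ g y) (comul h)).
Proof.
move=> a x y; rewrite linearP.
exact: (sweedler_linear (conv_bilinl f g) (conv_bilinr f g)).
Qed.

Definition conv f g : linhom H A := mk_linhom (conv_linear f g).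

Fact convA : associative conv.
Proof.
move=> f g l; apply: linhomP => h /=.
pose M := sweedler (fun y z => g y ⋆ l z).
have ML : linear M := sweedler_linear (conv_bilinl g l) (conv_bilinr g l).
pose T := sweedler (fun x t => f x ⋆ M t).
have Tl t : linear (fun x => f x ⋆ M t).
  by move=> a x x'; rewrite linearP; exact: numul_linearl.
have Tr x : linear (fun t => f x ⋆ M t).
  by move=> a t t'; rewrite ML; exact: numul_linearr.
have TL : linear T := sweedler_linear Tl Tr.
have TE x y z : T (x ⊗ (y ⊗ z)) = f x ⋆ (g y ⋆ l z).
  rewrite /T (sweedler_tens Tl Tr) /M.
  by rewrite (sweedler_tens (conv_bilinl g l) (conv_bilinr g l)).
have /(congr1 T) := comulA h.
rewrite !(linear_sweedler _ _ TL) => e.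
transitivity (sweedler (fun x y => T (sweedler
    (fun y1 y2 => x ⊗ (y1 ⊗ y2)) (comul y))) (comul h)).
  apply: eq_bigr => -[x y] _ /=.
  rewrite (linear_sweedler _ _ TL) (linear_sweedler _ _ (numul_linearr (f x))).
  by apply: eq_bigr => p _; rewrite TE.
rewrite -e; apply: eq_bigr => -[x y] _ /=.
rewrite (linear_sweedler _ _ TL) (linear_sweedler _ _ (numul_linearl (l y))).
by apply: eq_bigr => p _; rewrite TE numulA.
Qed.

Fact conv_linearl g : linear (conv^~ g).
Proof.
move=> a f f'; apply: linhomP => h /=; rewrite /sweedler scaler_sumr -big_split.
by apply: eq_bigr => p _; exact: (numul_linearl (g p.2)).
Qed.

Fact conv_linearr f : linear (conv f).
Proof.
move=> a g g'; apply: linhomP => h /=; rewrite /sweedler scaler_sumr -big_split.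
by apply: eq_bigr => p _; exact: (numul_linearr (f p.1)).
Qed.

HB.instance Definition _ :=
  Lmodule_isNuAlgebra.Build k (linhom H A) convA conv_linearl conv_linearr.

Fact linhom_act_linear (h : H) f : linear (fun g : H => f (g * h)).
Proof. by move=> a x y; rewrite mulrDl -scalerAl linearP. Qed.

Definition linhom_act (h : H) f : linhom H A := mk_linhom (linhom_act_linear h f).

Fact linhom_act_bilinear : bilinear_for
  (GRing.Scale.Law.clone k (linhom H A) *:%R _)
  (GRing.Scale.Law.clone k (linhom H A) *:%R _) linhom_act.
Proof.
split=> [f|h] a x y; apply: linhomP => g //=.
by rewrite mulrDr -scalerAr linearP.
Qed.

HB.instance Definition _ := bilinear_isBilinear.Build k H (linhom H A)
  (linhom H A) _ _ linhom_act linhom_act_bilinear.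

Fact hom_of_action_linear (act : {bilinear H -> A -> A}) (a : A) :
  linear (fun h => act h a).
Proof. exact: linearPl. Qed.

(** The map a |-> (h |-> h . a) from A to Hom(H, A). *)
Definition hom_of_action (act : {bilinear H -> A -> A}) (a : A) : linhom H A :=
  mk_linhom (hom_of_action_linear act a).

End Convolution.

(* Main.v *)
(** A partial action gives φ(b (h · a)) = φ(b) ⋆ (h ▷ φ(a)), and the symmetry
    axiom gives the mirror identity.  Convolution makes Hom(H, A) an H-module
    algebra, in which (h ▷ f) ⋆ g = Σ h₁ ▷ (f ⋆ (S(h₂) ▷ g)); with f = φ(a) and
    g = g' ▷ φ(b) the first identity then shows that B = H ▷ φ(A) is closed
    under products.  Evaluation at 1 inverts φ, and minimality holds because
    Σ h_i ▷ φ(a_i) takes the value Σ g h_i · a_i at g. *)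
Require Import Defs.
From HB Require Import structures.
From mathcomp Require Import all_boot all_order all_algebra.
From mathcomp Require Import boolp.

Set Implicit Arguments.
Unset Strict Implicit.
Unset Printing Implicit Defensive.

Import GRing.Theory.
Local Open Scope ring_scope.
Local Open Scope hopf_scope.

(** * Linear spans *)

Section Span.
Context (k : fieldType) (V : lmodType k) (X : V -> Prop).

Lemma in_span0 : in_span X 0.
Proof. by exists [::]; rewrite ?big_nil. Qed.

Lemma in_span_gen v : X v -> in_span X v.
Proof.
move=> Xv; exists [:: (1, v)]; last by rewrite big_seq1 scale1r.
by move=> p; rewrite inE => /eqP ->.
Qed.

Lemma in_spanP c u v : in_span X u -> in_span X v -> in_span X (c *: u + v).
Proof.
move=> [s sX ->] [t tX ->]; exists ([seq (c * p.1, p.2) | p <- s] ++ t).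
  by move=> p; rewrite mem_cat => /orP[/mapP[q /sX Xq ->]|/tX].
rewrite big_cat big_map scaler_sumr; congr (_ + _).
by apply: eq_bigr => p _; rewrite scalerA.
Qed.

Lemma in_span_sum (I : Type) (r : seq I) (c : I -> k) (F : I -> V) :
  (forall i, in_span X (F i)) -> in_span X (\sum_(i <- r) c i *: F i).
Proof.
move=> XF; elim/big_rec: _ => [|i v _ Xv]; first exact: in_span0.
exact: in_spanP.
Qed.

(** Reduces a claim about all of H ▷ φ(A) to its generators h ▷ φ(a). *)
Lemma in_span_ind (Y : V -> Prop) :
  Y 0 -> (forall c u v, X u -> Y v -> Y (c *: u + v)) ->
  forall v, in_span X v -> Y v.
Proof.
move=> Y0 YP v [s sX ->]; elim: s sX => [|p s IH] sX; first by rewrite big_nil.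
rewrite big_cons; apply: YP; first by apply: sX; rewrite mem_head.
by apply: IH => q qs; apply: sX; rewrite inE qs orbT.
Qed.

Lemma in_span_sweedler (U U' : lmodType k) (f : U -> U' -> V) t :
  (forall u u', in_span X (f u u')) -> in_span X (sweedler f t).
Proof.
move=> Xf; rewrite /sweedler; under eq_bigr do rewrite -[f _ _]scale1r.
exact: in_span_sum.
Qed.

End Span.

(** * Sweedler sums and coassociativity *)

Lemma eq_sweedler (k : fieldType) (U V : lmodType k) (W : nmodType)
    (f g : U -> V -> W) t : f =2 g -> sweedler f t = sweedler g t.
Proof. by move=> fg; apply: eq_bigr => p _; exact: fg. Qed.

(** The trilinear [F] induces a linear map [T] on H ⊗ (H ⊗ H); applying [T] to both sides of
    [comulA] gives the equation. *)
Lemma sweedler_coassoc (k : fieldType) (H : hopfAlgType k) (W : lmodType k)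
    (F : H -> H -> H -> W) (h : H) :
  (forall y z, linear (fun x => F x y z)) ->
  (forall x z, linear (fun y => F x y z)) ->
  (forall x y, linear (fun z => F x y z)) ->
  sweedler (fun x y => sweedler (fun x1 x2 => F x1 x2 y) (comul x)) (comul h) =
  sweedler (fun x y => sweedler (fun y1 y2 => F x y1 y2) (comul y)) (comul h).
Proof.
move=> F1 F2 F3.
pose T := sweedler (fun x t => sweedler (F x) t).
have T2 x : linear (sweedler (F x)) by apply: sweedler_linear.
have T1 t : linear (fun x => sweedler (F x) t).
  move=> a x y; rewrite /sweedler scaler_sumr -big_split.
  by apply: eq_bigr => p _; exact: F1.
have TL : linear T by apply: sweedler_linear.
have TE x y z : T (x ⊗ (y ⊗ z)) = F x y z by rewrite /T !sweedler_tens.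
have /(congr1 T) := comulA h; rewrite !(linear_sweedler _ _ TL) => e.
by etransitivity; [|etransitivity; [exact: e|]]; apply: eq_sweedler => x y;
  rewrite (linear_sweedler _ _ TL); apply: eq_sweedler => u v; rewrite TE.
Qed.

(** * Hom(H, A) as an H-module algebra, and the antipode identity *)

Section HomModuleAlgebra.
Context (k : fieldType) (H : hopfAlgType k) (A : nuAlgType k).
Implicit Types f g : linhom H A.

Lemma linhom_act1 f : linhom_act 1 f = f.
Proof. by apply: linhomP => h /=; rewrite mulr1. Qed.

Lemma linhom_actA (h g : H) f :
  linhom_act (h * g) f = linhom_act h (linhom_act g f).
Proof. by apply: linhomP => x /=; rewrite mulrA. Qed.

(** Since Δ(xh) = Δ(x)Δ(h), both sides take the value Σ f(x₁h₁) g(x₂h₂) at x. *)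
Lemma linhom_actM (h : H) f g : linhom_act h (f ⋆ g) =
  sweedler (fun h1 h2 => linhom_act h1 f ⋆ linhom_act h2 g) (comul h).
Proof.
apply: linhomP => x.
have evL : linear (fun l : linhom H A => l x) by [].
rewrite (linear_sweedler _ _ evL) /= comulM /tens_mul.
pose M := sweedler (fun y z => f y ⋆ g z).
have ML : linear M := sweedler_linear (conv_bilinl f g) (conv_bilinr f g).
rewrite -/(M _) (linear_sweedler _ _ ML).
under eq_sweedler => u v do rewrite (linear_sweedler _ _ ML).
(* The left side sums over Δ(x) outermost, the right side over Δ(h). *)
rewrite [LHS]exchange_big; apply: eq_bigr => p _; apply: eq_bigr => q _ /=.
exact: sweedler_tens (conv_bilinl f g) (conv_bilinr f g) _ _.
Qed.

Lemma linhom_module_algebra : module_algebra (@linhom_act k H A).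
Proof. by split; [exact: linhom_act1|exact: linhom_actA|exact: linhom_actM]. Qed.

End HomModuleAlgebra.

(** Σ h₁ ▷ (b (S(h₂) ▷ c)) = Σ (h₁ ▷ b)(h₂S(h₃) ▷ c) = Σ ε(h₂) (h₁ ▷ b)c = (h ▷ b)c. *)
Lemma module_algebra_antipode (k : fieldType) (H : hopfAlgType k)
    (B : nuAlgType k) (act : {bilinear H -> B -> B}) (h : H) (b c : B) :
  module_algebra act ->
  act h b ⋆ c =
  sweedler (fun h1 h2 => act h1 (b ⋆ act (antipode h2) c)) (comul h).
Proof.
move=> [act1 actA actM].
under [RHS]eq_sweedler => x y.
  rewrite actM; under eq_sweedler => x1 x2 do rewrite -actA.
  over.
rewrite (@sweedler_coassoc _ _ _
  (fun x y z => act x b ⋆ act (y * antipode z) c)) /=; first last.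
- move=> x y a u v.
  by rewrite linearP mulrDr -scalerAr linearPl /= numul_linearr.
(* Here the middle variable of the trilinear map varies. *)
- by move=> x z a u v; rewrite mulrDl -scalerAl linearPl /= numul_linearr.
- by move=> y z a u v; rewrite linearPl /= numul_linearl.
under [RHS]eq_sweedler => x y.
  have L : linear (fun z => act x b ⋆ act z c).
    by move=> a u v; rewrite linearPl /= numul_linearr.
  (* Linearity moves the inner sum inside the action, where Σ y₁S(y₂) = ε(y)1. *)
  rewrite -(linear_sweedler (fun y1 y2 => y1 * antipode y2) _ L).
  rewrite antipoder.
  over.
have L : linear (fun z => act z b ⋆ c).
  by move=> a u v; rewrite linearPl /= numul_linearl.
(* The left side is expanded by h = Σ ε(h₂)h₁ to match term by term. *)
rewrite -[in LHS](comul_counitr h) (linear_sweedler _ _ L).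
apply: eq_sweedler => x y.
by rewrite !linearZl_LR /= act1 !(linearZl_LR, linearZr_LR).
Qed.

(** * Transport of a partial action along an injective morphism *)

Section ImageAction.
Context (k : fieldType) (H : hopfAlgType k) (A B : nuAlgType k).
Context (pact : {bilinear H -> A -> A}) (theta : A -> B).
Context (hM : nualg_morphism theta) (hI : injective theta).
Let thetaA := nusubalg (image_nusubalg_closed hM).

(** This is θ⁻¹ on θ(A): the preimage is picked by choice, and injectivity of θ makes it unique,
    hence linear and multiplicative. *)
Definition image_preim (x : thetaA) : A := sval (cid (nusubalgP x)).

Lemma image_preimK (x : thetaA) : theta (image_preim x) = val x.
Proof. by rewrite /image_preim; case: cid. Qed.

Lemma image_preim_linear : linear image_preim.
Proof.
move=> a x y; apply: hI; rewrite (nualg_morphism_linear hM) !image_preimK.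
exact: linearP.
Qed.

Lemma image_preimM x y : image_preim (x ⋆ y) = image_preim x ⋆ image_preim y.
Proof. by apply: hI; rewrite (nualg_morphismM hM) !image_preimK. Qed.

Definition image_action (h : H) (x : thetaA) : thetaA :=
  to_nusubalg (image_nusubalg_closed hM)
    (ex_intro _ (pact h (image_preim x)) erefl).

Lemma image_action_preim h x :
  image_preim (image_action h x) = pact h (image_preim x).
Proof. by apply: hI; rewrite image_preimK. Qed.

Lemma image_preim_inj : injective image_preim.
Proof. by move=> x y e; apply: val_inj; rewrite -!image_preimK e. Qed.

Lemma image_action_bilinear : bilinear_for
  (GRing.Scale.Law.clone k thetaA *:%R _)
  (GRing.Scale.Law.clone k thetaA *:%R _) image_action.
Proof.
split=> [x|h] a u v; apply: image_preim_inj;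
  rewrite !(image_action_preim, image_preim_linear).
  exact: linearPl.
exact: linearPr.
Qed.

HB.instance Definition _ := bilinear_isBilinear.Build k H thetaA thetaA _ _
  image_action image_action_bilinear.

Lemma image_partial_action : partial_action pact ->
  exists2 bullet : {bilinear H -> thetaA -> thetaA},
    forall (h : H) (a : A) (x : thetaA),
      val x = theta a -> val (bullet h x) = theta (pact h a) &
    partial_action bullet.
Proof.
move=> [pact1 pactM]; exists image_action.
  by move=> h a x xa; congr (theta (pact h _)); apply: hI; rewrite image_preimK.
(* Both axioms are compared after θ⁻¹, which is injective, multiplicative and turns [image_action]
   into [pact]. *)
split=> [x|h g x y]; apply: image_preim_inj.
  by rewrite image_action_preim.
rewrite (linear_sweedler _ _ image_preim_linear) image_action_preim.
rewrite image_preimM image_action_preim pactM; apply: eq_sweedler => h1 h2.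
by rewrite image_preimM !image_action_preim.
Qed.

End ImageAction.

(** * The map φ and the subalgebra H ▷ φ(A) *)

Section HomOfAction.
Context (k : fieldType) (H : hopfAlgType k) (A : nuAlgType k).
Context (pact : {bilinear H -> A -> A}).
Local Notation phi := (hom_of_action pact).

Lemma hom_of_action_is_linear : linear phi.
Proof. by move=> c a b; apply: linhomP => h; exact: linearPr. Qed.

Context (hpact : symmetrical_partial_action pact).

(** At g the right side is Σ (g₁ · b)(g₂h · a), so this is the multiplicative axiom of a partial
    action read pointwise. *)
Lemma hom_of_action_mulr (h : H) a b :
  phi (b ⋆ pact h a) = phi b ⋆ linhom_act h (phi a).
Proof.
by apply: linhomP => g; exact: (partial_actionM (symmetrical_partial hpact)).
Qed.

Lemma hom_of_action_mull (h : H) a b :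
  phi (pact h a ⋆ b) = linhom_act h (phi a) ⋆ phi b.
Proof. by apply: linhomP => g; exact: (symmetrical_actionM hpact). Qed.

(** The case h = 1 of [hom_of_action_mulr], as 1 · b = b. *)
Lemma hom_of_actionM a b : phi (a ⋆ b) = phi a ⋆ phi b.
Proof.
rewrite -{1}(partial_action1 (symmetrical_partial hpact) b).
by rewrite hom_of_action_mulr linhom_act1.
Qed.

Lemma hom_of_action_inj : injective phi.
Proof.
have p1 := partial_action1 (symmetrical_partial hpact).
move=> a b /(congr1 (fun f : linhom H A => f 1)).
by rewrite -[LHS]/(pact 1 a) -[RHS]/(pact 1 b) !p1.
Qed.

Local Notation B := (act_span (@linhom_act k H A) phi).

Lemma act_span_gen (h : H) a : B (linhom_act h (phi a)).
Proof. by apply: in_span_gen; exists h, a. Qed.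

Lemma act_span_hom_of_action a : B (phi a).
Proof. by rewrite -[phi a]linhom_act1; exact: act_span_gen. Qed.

Lemma act_span_act (h : H) f : B f -> B (linhom_act h f).
Proof.
apply: (in_span_ind (Y := fun f => B (linhom_act h f))) => [|c _ v [g [a ->]] Bv].
  by rewrite linear0r; exact: in_span0.
rewrite linearPr; apply: in_spanP => //=.
by rewrite -linhom_actA; exact: act_span_gen.
Qed.

(** The product equals Σ h₁ ▷ φ(a (S(h₂)g · b)), a sum of generators. *)
Lemma act_span_mul_gen (h g : H) a b :
  B (linhom_act h (phi a) ⋆ linhom_act g (phi b)).
Proof.
rewrite (module_algebra_antipode _ _ _ (linhom_module_algebra H A)).
apply: in_span_sweedler => h1 h2 /=.
by rewrite -linhom_actA -hom_of_action_mulr; exact: act_span_gen.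
Qed.

Lemma act_span_nusubalg_closed : nusubalg_closed B.
Proof.
split; [exact: in_span0|exact: in_spanP|move=> f g Bf Bg].
(* Bilinearity reduces first the left factor, then the right one, to generators. *)
apply: (in_span_ind (Y := fun f => B (f ⋆ g))) Bf => [|c _ v [h [a ->]] Bv].
  by rewrite linear0l; exact: in_span0.
rewrite numul_linearl; apply: in_spanP Bv.
apply: (in_span_ind (Y := fun g => B (_ ⋆ g))) Bg => [|d _ w [h' [b ->]] Bw].
  by rewrite linear0r; exact: in_span0.
by rewrite numul_linearr; apply: in_spanP Bw; exact: act_span_mul_gen.
Qed.

End HomOfAction.

(** * Restriction of the action to a stable subalgebra *)

Lemma sub_module_algebra (k : fieldType) (H : hopfAlgType k) (B : nuAlgType k)
    (S : B -> Prop) (act : {bilinear H -> B -> B}) (hS : nusubalg_closed S)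
    (hact : forall (h : H) (b : B), S b -> S (act h b)) :
  module_algebra act -> module_algebra (sub_action act hS hact).
Proof.
move=> [act1 actA actM]; split=> [b|h g b|h b c]; apply: val_inj.
- exact: act1.
- exact: actA.
have valL : linear (val : nusubalg hS -> B) by exact: linearP.
rewrite (linear_sweedler _ _ valL); exact: actM.
Qed.

Lemma sub_act_span (k : fieldType) (H : hopfAlgType k) (A : Type)
    (B : nuAlgType k) (act : {bilinear H -> B -> B}) (f : A -> B)
    (hS : nusubalg_closed (act_span act f))
    (hact : forall (h : H) (b : B), act_span act f b -> act_span act f (act h b))
    (hf : forall a, act_span act f (f a)) (b : nusubalg hS) :
  act_span (sub_action act hS hact) (fun a => to_nusubalg hS (hf a)) b.
Proof.
(* Span induction runs over ambient vectors, so each one is given a lift to the subalgebra that lies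
   in the span there. *)
suff P v : act_span act f v -> exists2 b' : nusubalg hS, val b' = v &
    act_span (sub_action act hS hact) (fun a => to_nusubalg hS (hf a)) b'.
  by have [b' /val_inj ->] := P _ (nusubalgP b).
move: v; apply: in_span_ind => [|c _ v [h [a ->]] [b' <- Bb']].
  by exists 0; [exact: linear0|exact: in_span0].
exists (c *: sub_action act hS hact h (to_nusubalg hS (hf a)) + b').
  by rewrite linearP.
by apply: in_spanP Bb'; apply: in_span_gen; exists h, a.
Qed.

Theorem theorem41 (k : fieldType) (H : hopfAlgType k) (A : nuAlgType k)
    (pact : {bilinear H -> A -> A})
    (hpact : symmetrical_partial_action pact) :
  let B := act_span (@linhom_act k H A) (hom_of_action pact) in
  exists (hB : nusubalg_closed B)
         (hact : forall (h : H) (f : linhom H A), B f -> B (linhom_act h f))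
         (hphi : forall a : A, B (hom_of_action pact a)),
    minimal_globalization pact (sub_action (@linhom_act k H A) hB hact)
      (fun a : A => to_nusubalg hB (hphi a)).
Proof.
move=> B.
exists (act_span_nusubalg_closed hpact), (@act_span_act k H A pact),
  (act_span_hom_of_action pact).
set hB := act_span_nusubalg_closed hpact.
set theta := fun a => _.
have thetaM : nualg_morphism theta.
  split=> [c a b|a b]; apply: val_inj; last exact: (hom_of_actionM hpact).
  by rewrite linearP; exact: hom_of_action_is_linear.
have thetaI : injective theta.
  by move=> a b /(congr1 val); exact: (hom_of_action_inj hpact).
split.
  have modB := sub_module_algebra hB (@act_span_act k H A pact)
    (linhom_module_algebra H A).
  (* [thetaM] is supplied at once because the algebra θ(A) in [glob_partial] is built from it. *)
  apply: (@Globalization _ _ _ _ _ _ _ modB thetaM).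
  - exact: thetaI.
  - by move=> h a b; apply: val_inj; exact: (hom_of_action_mull hpact).
  - by move=> h a b; apply: val_inj; exact: (hom_of_action_mulr hpact).
  - exact: sub_act_span.
  - exact: image_partial_action thetaI (symmetrical_partial hpact).
move=> n h a e; apply: val_inj; rewrite linear_sum linear0.
(* The zero on the right is replaced by Σ g h_i · a_i, the value at g of Σ h_i ▷ φ(a_i). *)
apply: linhomP => g; rewrite -[RHS](e g).
by elim/big_rec2: _ => // i x f _ <-.
Qed.
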